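(* Let $\mathbf{k}$ be a field, $\beta_0,\beta_1,\gamma_0,\gamma_1\in\mathbf{k}$, and let $\alpha$ be the evaluation of closed dotted 1-manifolds determined by these four parameters, with associated state spaces $A(n)$. For $n\ge 2$, the set $\mathcal{D}_n$ of $n$-diagrams constitutes a basis of the state space $A(n)$ if and only if $\beta_1\gamma_1\neq 0$.
   Context: Dotted cobordisms. An (unoriented dotted) cobordism from $0$ to $n$ is a compact 1-manifold $M$ carrying finitely many interior dots, whose boundary is split into an inner part and an outer part, with a fixed bijection of the outer part with $\{1,\dots,n\}$. It is considered up to diffeomorphism rel outer boundary, so it is determined by which outer points are connected to which, the number of dots on each component, and its closed components (components without outer boundary: intervals and circles, each with some number of dots). $n$-diagrams. An $n$-diagram is such a cobordism from $0$ to $n$ with no closed components and at most one dot on each component. Each component is either an interval with exactly one outer endpoint (the other endpoint being inner) or an interval with two outer endpoints. Combinatorially, an $n$-diagram is a partition of $\{1,\dots,n\}$ into singletons and pairs, each block being either dotless or carrying one dot. $\mathcal{D}_n$ denotes the set of $n$-diagrams. Pairing. $\overline{y}$ is the reflection of a cobordism $y$ from $0$ to $n$ in a horizontal line, a cobordism from $n$ to $0$. $\overline{y}x$ is the closed dotted 1-manifold obtained by gluing $x$ and $\overline{y}$ along the $n$ outer points; each component is an interval or a circle, and dots add up under gluing. Evaluation. $\alpha$ is multiplicative under disjoint union (with value $1$ on the empty manifold); $\alpha$ equals $\beta_0$ on an interval without dots, $\beta_1$ on an interval with one dot, $\gamma_0$ on a circle without dots, $\gamma_1$ on a circle with one dot,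 and $0$ on any connected interval or circle with at least two dots. State space. $V(n)$ is the $\mathbf{k}$-vector space with basis all dotted cobordisms from $0$ to $n$ (arbitrary closed components and arbitrary numbers of dots allowed), with the bilinear form $(x,y)=\alpha(\overline{y}x)$ on basis elements. $A(n)=V(n)/\ker((\cdot,\cdot))$ is the quotient of $V(n)$ by the kernel of this form. That $\mathcal{D}_n$ constitutes a basis of $A(n)$ means that the images in $A(n)$ of the $n$-diagrams, as a family indexed by $\mathcal{D}_n$, form a basis. *)

(* Defs.v *)
From HB Require Import structures.
From mathcomp Require Import all_boot all_order all_algebra.
From mathcomp Require Import finmap multiset monalg.
From mathcomp Require Import boolp.

Set Implicit Arguments.
Unset Strict Implicit.
Unset Printing Implicit Defensive.

Import GRing.Theory.

Local Open Scope ring_scope.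

(* Families are indexed by an arbitrary, possibly infinite, type, so both
   conditions quantify over finite duplicate-free lists of indices. *)

Section Basis.
Variables (k : fieldType) (V : lmodType k) (I : eqType) (b : I -> V).

Definition lin_indep : Prop :=
  forall (s : seq I) (c : I -> k), uniq s ->
    \sum_(i <- s) c i *: b i = 0 -> forall i, i \in s -> c i = 0.

Definition spanning : Prop :=
  forall v : V, exists (s : seq I) (c : I -> k),
    uniq s /\ v = \sum_(i <- s) c i *: b i.

Definition is_basis : Prop := lin_indep /\ spanning.

End Basis.

(* Quotient.quot only provides an additive group. *)

Section LmodQuotient.
Variables (R : nzRingType) (V : lmodType R) (S : zmodClosed V)
  (SZ : scaler_closed S).

Definition lmod_quot of scaler_closed S : Type := Quotient.quot S.
Local Notation Q := (lmod_quot SZ).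

HB.instance Definition _ := GRing.Zmodule.copy Q (Quotient.quot S).

Definition lmod_pi (x : V) : Q := (\pi_(Quotient.quot S) x)%qT.

Lemma lmod_pi_eq (x y : V) : lmod_pi x = lmod_pi y <-> x - y \in S.
Proof. by rewrite Quotient.idealrBE; split=> /eqP. Qed.

Lemma lmod_pi_surj (v : Q) : exists x, v = lmod_pi x.
Proof. by exists (repr (v : Quotient.quot S)); rewrite /lmod_pi reprK. Qed.

Lemma lmod_piD (x y : V) : lmod_pi (x + y) = lmod_pi x + lmod_pi y.
Proof. exact: (raddfD (\pi_(Quotient.quot S))%qT). Qed.

Definition lmod_quot_scale (a : R) (v : Q) : Q :=
  lmod_pi (a *: repr (v : Quotient.quot S)).

Lemma lmod_quot_scaleE (a : R) (x : V) :
  lmod_quot_scale a (lmod_pi x) = lmod_pi (a *: x).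
Proof.
apply/lmod_pi_eq; rewrite -scalerBr; apply: SZ.
by apply/lmod_pi_eq; rewrite /lmod_pi reprK.
Qed.

Lemma lmod_quot_scaleA a b (v : Q) :
  lmod_quot_scale a (lmod_quot_scale b v) = lmod_quot_scale (a * b) v.
Proof. by have [x ->] := lmod_pi_surj v; rewrite !lmod_quot_scaleE scalerA. Qed.

Lemma lmod_quot_scale1 : left_id 1 lmod_quot_scale.
Proof.
by move=> v; have [x ->] := lmod_pi_surj v; rewrite lmod_quot_scaleE scale1r.
Qed.

Lemma lmod_quot_scaleDr : right_distributive lmod_quot_scale +%R.
Proof.
move=> a u v; have [x ->] := lmod_pi_surj u; have [y ->] := lmod_pi_surj v.
by rewrite -lmod_piD !lmod_quot_scaleE scalerDr lmod_piD.
Qed.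

Lemma lmod_quot_scaleDl (v : Q) : {morph lmod_quot_scale^~ v : a b / a + b}.
Proof.
move=> a b; have [x ->] := lmod_pi_surj v.
by rewrite !lmod_quot_scaleE scalerDl lmod_piD.
Qed.

HB.instance Definition _ := GRing.Zmodule_isLmodule.Build R Q
  lmod_quot_scaleA lmod_quot_scale1 lmod_quot_scaleDr lmod_quot_scaleDl.

Lemma lmod_pi_is_linear : linear lmod_pi.
Proof. by move=> a x y; rewrite lmod_piD -lmod_quot_scaleE. Qed.

HB.instance Definition _ := GRing.isLinear.Build R V Q _ lmod_pi
  lmod_pi_is_linear.

End LmodQuotient.

Inductive shape := Interval | Circle.

Definition bool_of_shape (s : shape) : bool :=
  if s is Circle then true else false.
Definition shape_of_bool (b : bool) : shape := if b then Circle else Interval.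
Lemma bool_of_shapeK : cancel bool_of_shape shape_of_bool.
Proof. by case. Qed.
HB.instance Definition _ := Finite.copy shape (can_type bool_of_shapeK).

(* A compact dotted 1-manifold without outer boundary, up to diffeomorphism:
   the multiset of its components, each given by its shape and its number of
   dots. *)
Definition closed_manifold : choiceType := {mset shape * nat}%mset.

(* A dotted cobordism from 0 to n up to diffeomorphism rel outer boundary.
   [blocks] records which outer points lie on a common component: a singleton
   is an interval whose other endpoint is inner, a pair an interval with two
   outer endpoints.  [dots] is required to vanish off the blocks, so that
   diffeomorphic cobordisms are equal. *)
Section Cobordism.
Variable n : nat.

Definition cob_data : Type :=
  {set {set 'I_n}} * {ffun {set 'I_n} -> nat} * closed_manifold.
HB.instance Definition _ := Choice.on cob_data.

Definition is_cob (x : cob_data) : bool :=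
  let: (P, d, _) := x in
  [&& partition P [set: 'I_n],
      [forall B in P, #|B| <= 2]%N
    & [forall B, (B \notin P) ==> (d B == 0%N)]].

Record dotted_cob := DottedCob { cob_val : cob_data; _ : is_cob cob_val }.
HB.instance Definition _ := [isSub for cob_val].
HB.instance Definition _ := [Choice of dotted_cob by <:].

Definition blocks (x : dotted_cob) : {set {set 'I_n}} := (cob_val x).1.1.
Definition dots (x : dotted_cob) : {ffun {set 'I_n} -> nat} := (cob_val x).1.2.
Definition closed_part (x : dotted_cob) : closed_manifold := (cob_val x).2.

Definition is_diagram (x : dotted_cob) : bool :=
  (closed_part x == mset0) && [forall B in blocks x, dots x B <= 1]%N.

Record diagram := Diagram { diagram_val :> dotted_cob;
                            _ : is_diagram diagram_val }.
HB.instance Definition _ := [isSub for diagram_val].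
HB.instance Definition _ := [Choice of diagram by <:].

(* [glue y x] is the closed manifold obtained from x and the reflection of y,
   which is described by the same combinatorial data as y. *)
Section Gluing.
Variables y x : dotted_cob.

Definition glue_rel : rel 'I_n :=
  [rel i j | [exists B in blocks x :|: blocks y, (i \in B) && (j \in B)]].

Definition glue_components : {set {set 'I_n}} :=
  equivalence_partition (connect glue_rel) [set: 'I_n].

(* A component through outer points is an interval exactly when it has an
   inner endpoint, i.e. runs through a singleton block of x or of y. *)
Definition glue_shape (C : {set 'I_n}) : shape :=
  if [exists B in blocks x :|: blocks y, (B \subset C) && (#|B| == 1%N)]
  then Interval else Circle.

Definition glue_dots (C : {set 'I_n}) : nat :=
  (\sum_(B in blocks x | B \subset C) dots x B
   + \sum_(B in blocks y | B \subset C) dots y B)%N.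

Definition glue : closed_manifold :=
  (closed_part x `+` closed_part y
   `+` seq_mset [seq (glue_shape C, glue_dots C)
                | C <- enum glue_components])%mset.

End Gluing.

End Cobordism.

Section StateSpace.
Variables (k : fieldType) (beta0 beta1 gamma0 gamma1 : k).

Definition alpha_component (c : shape * nat) : k :=
  match c with
  | (Interval, 0%N) => beta0
  | (Interval, 1%N) => beta1
  | (Circle, 0%N) => gamma0
  | (Circle, 1%N) => gamma1
  | _ => 0
  end.

Definition alpha (M : closed_manifold) : k :=
  \prod_(c <- (M : {mset shape * nat}%mset)) alpha_component c.

Variable n : nat.

Definition cob_space : lmodType k := {malg k[dotted_cob n]}.

Definition cob_form (u v : cob_space) : k :=
  \sum_(x <- msupp u) \sum_(y <- msupp v) u@_x * v@_y * alpha (glue y x).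

Lemma cob_formEw (u v : cob_space) (D : {fset dotted_cob n}) :
  (msupp u `<=` D)%fset ->
  cob_form u v =
  \sum_(x <- D) \sum_(y <- msupp v) u@_x * v@_y * alpha (glue y x).
Proof.
move=> uD; rewrite /cob_form (big_fset_incl _ uD) //= => x _ xu.
by rewrite big1 // => y _; rewrite (mcoeff_outdom xu) !mul0r.
Qed.

Lemma cob_form_linear (a : k) (u u' v : cob_space) :
  cob_form (a *: u + u') v = a * cob_form u v + cob_form u' v.
Proof.
pose D := (msupp u `|` msupp u' `|` msupp (a *: u + u'))%fset.
rewrite !(@cob_formEw _ v D) /D; last first.
- exact: fsubsetUr.
- by rewrite -fsetUA fsubsetUl.
- by rewrite fsetUAC fsubsetUr.
rewrite mulr_sumr -big_split /=; apply: eq_bigr => x _.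
rewrite mulr_sumr -big_split /=; apply: eq_bigr => y _.
by rewrite mcoeffD mcoeffZ !mulrDl !mulrA.
Qed.

(* The form is symmetric, so its left and right kernels agree. *)
Definition cob_kernel : {pred cob_space} :=
  [pred u | `[< forall v : cob_space, cob_form u v = 0 >]].

Lemma cob_kernelP u :
  reflect (forall v, cob_form u v = 0) (u \in cob_kernel).
Proof. by rewrite inE; apply: asboolP. Qed.

Lemma cob_kernel_zmod_closed : zmod_closed cob_kernel.
Proof.
have F0 v : cob_form 0 v = 0.
  have := cob_form_linear (-1) 0 0 v.
  by rewrite scaler0 addr0 mulN1r addNr.
split=> [|u u' /cob_kernelP hu /cob_kernelP hu']; apply/cob_kernelP=> v //.
by rewrite addrC -scaleN1r cob_form_linear hu hu' mulr0 addr0.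
Qed.

Lemma cob_kernel_scaler_closed : scaler_closed cob_kernel.
Proof.
move=> a u /cob_kernelP hu; apply/cob_kernelP=> v.
have /cob_kernelP/(_ v) F0 := cob_kernel_zmod_closed.1.
by rewrite -[a *: u]addr0 cob_form_linear hu F0 mulr0 addr0.
Qed.

HB.instance Definition _ :=
  GRing.isZmodClosed.Build cob_space cob_kernel cob_kernel_zmod_closed.

Definition state_space : lmodType k := lmod_quot cob_kernel_scaler_closed.

Definition state_class (x : dotted_cob n) : state_space :=
  lmod_pi cob_kernel_scaler_closed << x >>.

End StateSpace.

(* Main.v *)
Require Import Defs.
From mathcomp Require Import all_boot all_algebra.
From mathcomp Require Import finmap multiset monalg boolp zify.
Import GRing.Theory.
Local Open Scope ring_scope.

Set Implicit Arguments.
Unset Strict Implicit.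
Unset Printing Implicit Defensive.

(** The pairing of two cobordisms is a product over the components of the
    glued manifold, and a component with two or more dots contributes zero.
    Every argument below counts dots on components.

    Spanning holds for all parameters: in the state space a closed component
    is a scalar, and a component with two dots kills the cobordism
    ([class_in_span]).

    Suppose [beta1 * gamma1 != 0].  Pair a diagram [E] with the dual of a
    diagram [D]: the same blocks, with the dots on the complementary set of
    blocks.  For [E = D] every component carries exactly one dot, so the value
    is a product of factors [beta1] and [gamma1], hence nonzero.  In general,
    let [c] be the number of components.  If the value is nonzero then
    [d(E) + #D - d(D) <= c], where [d] counts dots and [#] blocks, while [c]
    is at most [#D] and at most [#E], each component being a union of blocks
    of either diagram.  So [2 d - #] cannot be larger for [E] than for [D],
    and if it is equal then all these inequalities are equalities, which
    forces [E = D] ([dual_triangular]).  The matrix of pairings of diagrams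
    with duals of diagrams is thus triangular with nonzero diagonal.

    Suppose [beta1 * gamma1 = 0].  Let [X] be the diagram of dotted
    singletons and [Y] the one obtained by merging two of its singletons into
    a dotted pair.  Then [X - beta1 Y] pairs to zero with every cobordism [y]
    ([alpha_glue_degenerate]).  Indeed, if [y] joins two distinct blocks of
    [Y], both pairings vanish because of a component with two dots; if [y]
    contains the pair of [Y] as a block, then [X] gives two dots on an
    interval, and [beta1 Y] gives a factor [beta1 * gamma1] or a circle with
    two dots; if [y] has only singletons, then both sides vanish unless [y]
    has no dots, in which case [X] has exactly one factor [beta1] more than
    [Y]. *)

(** * Refinement of set partitions *)

Section Refinement.
Variable T : finType.
Implicit Types P R : {set {set T}}.

Definition refines P R := [forall B in P, exists C in R, B \subset C].

Lemma refinesP P R :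
  reflect (forall B, B \in P -> exists2 C, C \in R & B \subset C) (refines P R).
Proof.
by apply: (iffP forall_inP) => h B /h /exists_inP.
Qed.

Lemma mem_partition_eq P D B C x :
  partition P D -> B \in P -> C \in P -> x \in B -> x \in C -> B = C.
Proof.
move=> /partition_trivIset tP BP CP xB xC.
by rewrite -(def_pblock tP BP xB) (def_pblock tP CP xC).
Qed.

Lemma partition_pblock P x :
  partition P [set: T] -> pblock P x \in P /\ x \in pblock P x.
Proof.
move=> /cover_partition cP; have xc : x \in cover P by rewrite cP inE.
by rewrite mem_pblock xc pblock_mem.
Qed.

Lemma partition_point P D B :
  partition P D -> B \in P -> exists x, x \in B.
Proof. by move=> pP /(partition_neq0 pP) /set0Pn. Qed.

(** For [P] refining a partition [R], this is the surjection from [P] onto [R]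
    given by inclusion; all counting of blocks against components uses it. *)
Definition super_block R (B : {set T}) : {set T} :=
  odflt set0 [pick C in R | B \subset C].

Lemma super_blockP P R B : refines P R -> B \in P ->
  super_block R B \in R /\ B \subset super_block R B.
Proof.
move=> /refinesP rPR /rPR [C CR BC]; rewrite /super_block.
by case: pickP => [D /andP[]|/(_ C)] //=; rewrite CR BC.
Qed.

Section TwoPartitions.
Variables P R : {set {set T}}.
Hypotheses (pP : partition P [set: T]) (pR : partition R [set: T]).
Hypothesis rPR : refines P R.

Lemma super_block_eq B C :
  B \in P -> C \in R -> (super_block R B == C) = (B \subset C).
Proof.
move=> BP CR; have [sR Bs] := super_blockP rPR BP.
apply/eqP/idP => [<- //|BC]; have [x xB] := partition_point pP BP.
exact: (mem_partition_eq pR sR CR (subsetP Bs x xB) (subsetP BC x xB)).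
Qed.

Lemma super_block_onto : super_block R @: P = R.
Proof.
apply/setP=> C; apply/imsetP/idP => [[B BP ->]|CR].
  by have [] := super_blockP rPR BP.
have [x xC] := partition_point pR CR; have [BP xB] := partition_pblock x pP.
exists (pblock P x) => //; have [sR Bs] := super_blockP rPR BP.
exact: (mem_partition_eq pR CR sR xC (subsetP Bs x xB)).
Qed.

Lemma refines_card : (#|R| <= #|P|)%N.
Proof. by rewrite -super_block_onto leq_imset_card. Qed.

(** Equal cardinalities make the surjection [super_block] injective, so each
    block of [R] contains a single block of [P], which must fill it. *)
Lemma refines_card_eq : (#|P| <= #|R|)%N -> P = R.
Proof.
move=> PR; apply/esym/eqP; rewrite eqEcard PR andbT; apply/subsetP => C CR.
have inj : {in P &, injective (super_block R)}.
  by apply/imset_injP; rewrite super_block_onto eqn_leq PR refines_card.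
have [x xC] := partition_point pR CR; have [BP xB] := partition_pblock x pP.
have sub y : y \in C -> super_block R (pblock P y) = C.
  move=> yC; have [B'P yB] := partition_pblock y pP.
  have [sR Bs] := super_blockP rPR B'P.
  exact: (mem_partition_eq pR sR CR (subsetP Bs y yB) yC).
suff -> : C = pblock P x by [].
apply/eqP; rewrite eqEsubset; apply/andP; split; last first.
  by rewrite -super_block_eq // sub.
apply/subsetP=> y yC; have [B'P yB] := partition_pblock y pP.
by rewrite (inj (pblock P x) (pblock P y)) ?sub.
Qed.

Lemma refines_sum (f : {set T} -> nat) :
  (\sum_(B in P) f B = \sum_(C in R) \sum_(B in P | B \subset C) f B)%N.
Proof.
rewrite (partition_big (super_block R) (mem R)) => [|B BP]; last first.
  by have [] := super_blockP rPR BP.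
apply: eq_bigr => C CR; apply: eq_bigl => B.
by case BP: (B \in P); rewrite //= super_block_eq.
Qed.

End TwoPartitions.

Lemma sum_sub_block P D (f : {set T} -> nat) B :
  partition P D -> B \in P ->
  (\sum_(B' in P | B' \subset B) f B' = f B)%N.
Proof.
move=> pP BP; apply: big_pred1 => B' /=; apply/andP/eqP => [[B'P B'B]|-> //].
have [i iB'] := partition_point pP B'P.
exact: (mem_partition_eq pP B'P BP iB' (subsetP B'B i iB')).
Qed.

Lemma refines_anti P R : partition P [set: T] -> partition R [set: T] ->
  refines P R -> refines R P -> P = R.
Proof.
by move=> pP pR PR RP; apply: refines_card_eq => //; apply: refines_card.
Qed.

Lemma refines_refl P : refines P P.
Proof. by apply/refinesP => B BP; exists B. Qed.

Definition singletons (A : {set T}) : {set {set T}} := set1 @: A.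

Lemma singletons_partition A : partition (singletons A) A.
Proof.
apply/and3P; split.
- apply/eqP/setP => x; apply/bigcupP/idP => [|xA].
    by case=> B /imsetP[y yA ->] /set1P ->.
  by exists [set x]; rewrite ?set11 ?imset_f.
- apply/trivIsetP => B C /imsetP[x _ ->] /imsetP[y _ ->] xy.
  by rewrite disjoints1 inE; apply: contraNneq xy => ->.
- by apply/imsetP => -[x _ /setP/(_ x)]; rewrite !inE eqxx.
Qed.

Lemma card_singletons A B : B \in singletons A -> #|B| = 1%N.
Proof. by case/imsetP => x _ ->; rewrite cards1. Qed.

Lemma mem_singletons A x : ([set x] \in singletons A) = (x \in A).
Proof. by apply: mem_imset => a b /set1_inj. Qed.

End Refinement.

(** * Components of a glued manifold *)

Section Glue.
Variable n : nat.
Implicit Types (x y : dotted_cob n) (B C : {set 'I_n}).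

Lemma blocks_partition x : partition (blocks x) [set: 'I_n].
Proof. by case: x => -[[P d] c] h; have /and3P[] := h. Qed.

Lemma blocks_card x B : B \in blocks x -> (#|B| <= 2)%N.
Proof.
case: x => -[[P d] c] h; rewrite /blocks /=.
by have /and3P[_ /forall_inP h2 _] := h; apply: h2.
Qed.

Lemma dots_off x B : B \notin blocks x -> dots x B = 0%N.
Proof.
case: x => -[[P d] c] h; rewrite /blocks /dots /= => BP.
by have /and3P[_ _ /forallP/(_ B)] := h; rewrite BP => /eqP.
Qed.

Lemma dotted_cob_eq x y : blocks x = blocks y ->
  {in blocks x, dots x =1 dots y} -> closed_part x = closed_part y -> x = y.
Proof.
move=> eb ed ec.
have {}ed : dots x = dots y.
  apply/ffunP=> B; case Bx: (B \in blocks x); first exact: ed.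
  by rewrite !dots_off -?eb ?Bx.
apply: val_inj; move: eb ed ec; rewrite /blocks /dots /closed_part /=.
by case: (cob_val x) => -[? ?] ?; case: (cob_val y) => -[? ?] ? /= -> -> ->.
Qed.

Lemma glue_rel_sym y x : symmetric (glue_rel y x).
Proof.
move=> i j.
by apply/exists_inP/exists_inP => -[B ? ?]; exists B; rewrite // andbC.
Qed.

Lemma glue_components_partition y x :
  partition (glue_components y x) [set: 'I_n].
Proof.
apply: equivalence_partitionP => i j l _ _ _; split=> // ij.
exact: (same_connect (sym_connect_sym (glue_rel_sym y x)) ij).
Qed.

Lemma mem_glue_components y x C i j : C \in glue_components y x ->
  i \in C -> j \in C -> connect (glue_rel y x) i j.
Proof.
case/imsetP=> l _ ->; rewrite !inE => li lj.
by rewrite (connect_trans _ lj) // (sym_connect_sym (glue_rel_sym y x)).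
Qed.

Lemma glue_component_connect y x C i j : C \in glue_components y x ->
  i \in C -> connect (glue_rel y x) i j -> j \in C.
Proof.
case/imsetP=> l _ ->; rewrite !inE => li ij; exact: (connect_trans li ij).
Qed.

Lemma refines_glue y x : refines (blocks x :|: blocks y) (glue_components y x).
Proof.
apply/refinesP => B Bxy.
have [i iB] : exists i, i \in B.
  by case/setUP: Bxy => /(partition_point (blocks_partition _)).
have [CG iC] := partition_pblock i (glue_components_partition y x).
exists (pblock (glue_components y x) i) => //; apply/subsetP => j jB.
apply: (glue_component_connect CG iC); apply: connect1.
by apply/exists_inP; exists B; rewrite // iB jB.
Qed.

Lemma refines_gluel y x : refines (blocks x) (glue_components y x).
Proof.
apply/refinesP => B Bx; have /refinesP h := refines_glue y x.
by apply: h; rewrite inE Bx.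
Qed.

Lemma refines_gluer y x : refines (blocks y) (glue_components y x).
Proof.
apply/refinesP => B By; have /refinesP h := refines_glue y x.
by apply: h; rewrite inE By orbT.
Qed.

(** The components are the finest partition that both families of blocks
    refine; this is the form in which that minimality is used. *)
Lemma glue_component_sub y x C (S : {set 'I_n}) i :
  C \in glue_components y x -> i \in C -> i \in S ->
  (forall B j, B \in blocks x :|: blocks y -> j \in B -> j \in S ->
     B \subset S) ->
  C \subset S.
Proof.
move=> CG iC iS clS; apply/subsetP => j jC.
have cl : closed (glue_rel y x) (mem S).
  apply: (intro_closed (sym_connect_sym (glue_rel_sym y x))) => a b.
  case/exists_inP=> B Bxy /andP[aB bB] aS.
  exact: (subsetP (clS B a Bxy aB aS)).
by have := closed_connect cl (mem_glue_components CG iC jC); rewrite iS => <-.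
Qed.

Lemma glue_refined y x :
  refines (blocks y) (blocks x) -> glue_components y x = blocks x.
Proof.
move=> yx; apply/esym/refines_anti.
- exact: blocks_partition.
- exact: glue_components_partition.
- exact: refines_gluel.
apply/refinesP => C CG.
have [i iC] := partition_point (glue_components_partition y x) CG.
have [Bx iB] := partition_pblock i (blocks_partition x).
exists (pblock (blocks x) i) => //; apply: (glue_component_sub CG iC iB).
move=> B j Bxy jB jP.
have /refinesP h : refines (blocks x :|: blocks y) (blocks x).
  apply/refinesP => D /setUP[Dx|]; first by exists D.
  by apply/refinesP.
have [D Dx BD] := h B Bxy; have jD := subsetP BD j jB.
by rewrite -(mem_partition_eq (blocks_partition x) Dx Bx jD jP).
Qed.

Lemma common_block_component y x B :
  B \in blocks x -> B \in blocks y -> B \in glue_components y x.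
Proof.
move=> Bx By; have /refinesP/(_ B Bx) [C CG BC] := refines_gluel y x.
suff -> : B = C by [].
apply/eqP; rewrite eqEsubset BC /=.
have [i iB] := partition_point (blocks_partition x) Bx.
apply: (glue_component_sub CG (subsetP BC i iB) iB) => D j Dxy jD jB.
case/setUP: Dxy => Dz.
  by rewrite (mem_partition_eq (blocks_partition x) Dz Bx jD jB).
by rewrite (mem_partition_eq (blocks_partition y) Dz By jD jB).
Qed.

Lemma sum_glue_dots y x :
  (\sum_(C in glue_components y x) glue_dots y x C
   = \sum_(B in blocks x) dots x B + \sum_(B in blocks y) dots y B)%N.
Proof.
rewrite big_split /=; have pG := glue_components_partition y x.
rewrite -(refines_sum (blocks_partition x) pG (refines_gluel y x)).
by rewrite -(refines_sum (blocks_partition y) pG (refines_gluer y x)).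
Qed.

Lemma glue_dots_block y x B : B \in blocks x -> B \in blocks y ->
  glue_dots y x B = (dots x B + dots y B)%N.
Proof.
by move=> Bx By; rewrite /glue_dots !(sum_sub_block _ (blocks_partition _)).
Qed.

Lemma glue_dots_gel y x B C :
  B \in blocks x -> B \subset C -> (dots x B <= glue_dots y x C)%N.
Proof.
move=> Bx BC; rewrite /glue_dots (bigD1 B) /=; last by rewrite Bx.
by rewrite -addnA leq_addr.
Qed.

Lemma glue_dots_geD y x B (B' : {set 'I_n}) C :
  B \in blocks x -> B' \in blocks y -> B \subset C -> B' \subset C ->
  (dots x B + dots y B' <= glue_dots y x C)%N.
Proof.
move=> Bx B'y BC B'C; apply: leq_add.
  by rewrite (bigD1 B) /= ?leq_addr // Bx.
by rewrite (bigD1 B') /= ?leq_addr // B'y.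
Qed.

Lemma glue_dots_ge2 y x B (B' : {set 'I_n}) C :
  B \in blocks x -> B' \in blocks x -> B != B' -> B \subset C -> B' \subset C ->
  (dots x B + dots x B' <= glue_dots y x C)%N.
Proof.
move=> Bx B'x BB' BC B'C; rewrite /glue_dots (bigD1 B) /= ?Bx //.
rewrite (bigD1 B') /= ?B'x ?B'C 1?eq_sym // -!addnA leq_add2l.
exact: leq_addr.
Qed.

(** * Dual diagrams and triangularity *)

Section CobOf.
Variables (P : {set {set 'I_n}}) (f : {set 'I_n} -> nat).
Hypothesis pP : partition P [set: 'I_n].
Hypothesis P2 : [forall B in P, #|B| <= 2]%N.

Fact cob_of_subproof :
  is_cob (P, [ffun B => if B \in P then f B else 0%N], mset0).
Proof.
apply/and3P; split=> //; apply/forallP => B; apply/implyP => BP.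
by rewrite ffunE (negbTE BP).
Qed.

Definition cob_of : dotted_cob n := DottedCob cob_of_subproof.

Lemma blocks_cob_of : blocks cob_of = P. Proof. by []. Qed.
Lemma closed_cob_of : closed_part cob_of = mset0. Proof. by []. Qed.
Lemma dots_cob_of B : B \in P -> dots cob_of B = f B.
Proof. by move=> BP; rewrite /dots ffunE BP. Qed.

Lemma cob_of_diagram :
  (forall B, B \in P -> f B <= 1)%N -> is_diagram cob_of.
Proof.
move=> f1; apply/andP; split; first by rewrite closed_cob_of.
by apply/forall_inP => B BP; rewrite dots_cob_of ?f1.
Qed.

End CobOf.

Lemma blocks_cards x : [forall B in blocks x, #|B| <= 2]%N.
Proof. by apply/forall_inP => B; apply: blocks_card. Qed.

Definition redot x (f : {set 'I_n} -> nat) :=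
  cob_of f (blocks_partition x) (blocks_cards x).

(** On a diagram this exchanges dotted and dotless blocks. *)
Definition dual x := redot x (fun B => 1 - dots x B)%N.

Definition n_dots x : nat := \sum_(B in blocks x) dots x B.

(** Up to a constant independent of [x] this is twice the number of dots
    minus the number of blocks, i.e. for a diagram the number of dotted blocks
    minus the number of dotless ones; complementing the set of blocks keeps it
    a natural number. *)
Definition weight x : nat := (2 * n_dots x + #|~: blocks x|)%N.

Lemma diagram_dots_le1 x B : is_diagram x -> (dots x B <= 1)%N.
Proof.
case/andP=> _ /forall_inP d1; case Bx: (B \in blocks x); first exact: d1.
by rewrite dots_off ?Bx.
Qed.

Lemma n_dots_dual x :
  is_diagram x -> (n_dots (dual x) + n_dots x = #|blocks x|)%N.
Proof.
move=> dx; rewrite /n_dots -big_split /= -sum1_card; apply: eq_bigr => B Bx.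
by rewrite dots_cob_of // subnK // diagram_dots_le1.
Qed.

(** Components without repeated dots give
    [n_dots E + #|blocks D| - n_dots D <= #|G|], and [#|G|] is bounded by both
    numbers of blocks.  With the inequality on weights all of these become
    equalities: the blocks of [D] and of [E] are the components, and each
    component carries exactly one dot. *)
Lemma dual_triangular D E : is_diagram D -> is_diagram E ->
  (forall C, C \in glue_components (dual D) E ->
     glue_dots (dual D) E C <= 1)%N ->
  (weight D <= weight E)%N -> D = E.
Proof.
move=> dD dE le1 wDE; set G := glue_components (dual D) E in le1.
have pG : partition G _ := glue_components_partition (dual D) E.
have rD : refines (blocks D) G := refines_gluer (dual D) E.
have rE : refines (blocks E) G := refines_gluel (dual D) E.
have cD := refines_card (blocks_partition D) pG rD.
have cE := refines_card (blocks_partition E) pG rE.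
have sG : (\sum_(C in G) glue_dots (dual D) E C = n_dots E + n_dots (dual D))%N.
  exact: sum_glue_dots.
have tot : (n_dots E + n_dots (dual D) <= #|G|)%N.
  by rewrite -sG -sum1_card; apply: leq_sum => C /le1.
have nD := n_dots_dual dD.
have CD := cardsC (blocks D); have CE := cardsC (blocks E).
move: wDE; rewrite /weight => wDE.
have DG : blocks D = G.
  by apply: (refines_card_eq (blocks_partition D) pG rD); lia.
have EG : blocks E = G.
  by apply: (refines_card_eq (blocks_partition E) pG rE); lia.
have sG1 : (\sum_(C in G) glue_dots (dual D) E C == \sum_(C in G) 1)%N.
  by rewrite sG sum1_card -DG; apply/eqP; lia.
(* The total is the number of components and no component exceeds one. *)
have := sG1; rewrite (leqif_sum (fun C CG => leqif_eq (le1 C CG))).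
move=> /forall_inP all1.
apply: dotted_cob_eq; first by rewrite DG.
  move=> B BD; have BG : B \in G by rewrite -DG.
  have BE : B \in blocks E by rewrite EG.
  have /eqP := all1 B BG; rewrite glue_dots_block ?dots_cob_of //.
  by move: (dots E B) (dots D B) (diagram_dots_le1 B dD) => e d; lia.
by case/andP: dD => /eqP -> _; case/andP: dE => /eqP -> _.
Qed.

End Glue.

(** * Evaluation of a pairing *)

Section Evaluation.
Variables (k : fieldType) (beta0 beta1 gamma0 gamma1 : k).
Local Notation alpha := (alpha beta0 beta1 gamma0 gamma1).
Local Notation alpha_component := (alpha_component beta0 beta1 gamma0 gamma1).

Lemma alphaD (M N : closed_manifold) :
  alpha (M `+` N)%mset = alpha M * alpha N.
Proof.
rewrite /alpha -big_cat /=; apply: perm_big.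
by apply/allP => c _ /=; rewrite count_cat !count_mem_mset msetE2.
Qed.

Lemma alpha0 : alpha mset0 = 1.
Proof. by rewrite /alpha enum_mset0 big_nil. Qed.

Lemma alpha_component_ge2 s d : (2 <= d)%N -> alpha_component (s, d) = 0.
Proof. by case: s d => -[|[|d]]. Qed.

Section Pairing.
Variable n : nat.
Implicit Types (x y : dotted_cob n) (B C : {set 'I_n}).

Lemma alpha_glue y x :
  alpha (glue y x) = alpha (closed_part x) * alpha (closed_part y) *
    \prod_(C in glue_components y x)
       alpha_component (glue_shape y x C, glue_dots y x C).
Proof.
rewrite /glue !alphaD; congr (_ * _); rewrite /alpha.
by rewrite (perm_big _ (perm_eq_seq_mset _)) big_map big_enum.
Qed.

Lemma alpha_glue_eq0 y x C :
  C \in glue_components y x -> (2 <= glue_dots y x C)%N ->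
  alpha (glue y x) = 0.
Proof.
move=> CG C2; rewrite alpha_glue (bigD1 C CG) alpha_component_ge2 //.
by rewrite /= mul0r mulr0.
Qed.

Lemma alpha_glue_dual_eq0 (D E : dotted_cob n) : is_diagram D -> is_diagram E ->
  (weight D <= weight E)%N -> D != E -> alpha (glue (dual D) E) = 0.
Proof.
move=> dD dE wDE DE; apply: contraNeq DE => nz; apply/eqP.
apply: dual_triangular => // C CG; rewrite leqNgt; apply/negP => C2.
by rewrite (alpha_glue_eq0 CG C2) eqxx in nz.
Qed.

Lemma alpha_glue_dual_neq0 (D : dotted_cob n) :
  is_diagram D -> beta1 * gamma1 != 0 ->
  alpha (glue (dual D) D) != 0.
Proof.
move=> dD; rewrite mulf_eq0 negb_or => /andP[b1 g1].
have [/eqP cD _] := andP dD.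
rewrite alpha_glue cD alpha0 !mul1r prodf_seq_neq0.
apply/allP => C _; apply/implyP; rewrite glue_refined ?refines_refl // => CD.
rewrite glue_dots_block // dots_cob_of // subnKC ?diagram_dots_le1 //.
by case: glue_shape.
Qed.

(** Each component is a block of [x] with its dot, cut into an interval by the
    singletons of [y]. *)
Lemma alpha_glue_all_dotted y x :
  {in blocks x, forall B, dots x B = 1%N} ->
  closed_part x = mset0 ->
  {in blocks y, forall B, #|B| = 1%N} ->
  {in blocks y, forall B, dots y B = 0%N} ->
  alpha (glue y x) = alpha (closed_part y) * beta1 ^+ #|blocks x|.
Proof.
move=> x1 cx sy y0.
have yx : refines (blocks y) (blocks x).
  apply/refinesP => B By.
  have [i iB] := partition_point (blocks_partition y) By.
  have [Px iP] := partition_pblock i (blocks_partition x).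
  exists (pblock (blocks x) i) => //.
  have /eqP/cards1P[j eB] := sy B By.
  by rewrite eB sub1set; move: iB; rewrite eB => /set1P <-.
rewrite alpha_glue cx alpha0 mul1r glue_refined //; congr (_ * _).
rewrite -prodr_const; apply: eq_bigr => C Cx.
have -> : glue_dots y x C = 1%N.
  rewrite /glue_dots (sum_sub_block _ (blocks_partition x) Cx) x1 //.
  by rewrite big1 // => B /andP[By _]; apply: y0.
suff -> : glue_shape y x C = Defs.Interval by [].
rewrite /glue_shape ifT //.
have [i iC] := partition_point (blocks_partition x) Cx.
have [By iB] := partition_pblock i (blocks_partition y).
apply/exists_inP; exists (pblock (blocks y) i); first by rewrite inE By orbT.
have /eqP/cards1P[j eB] := sy _ By.
by move: iB; rewrite eB => /set1P <-; rewrite sub1set iC cards1.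
Qed.

(** Some block of [y] joins two blocks of [x], whose dots then lie on a common
    component. *)
Lemma alpha_glue_dotted_sub_eq0 y x :
  {in blocks x, forall B, dots x B = 1%N} ->
  ~~ refines (blocks y) (blocks x) -> alpha (glue y x) = 0.
Proof.
move=> x1 /forall_inPn [B By /exists_inPn noC].
have [i iB] := partition_point (blocks_partition y) By.
have [Px iP] := partition_pblock i (blocks_partition x).
have /subsetPn [j jB jP] := noC _ Px.
have [Pj jPj] := partition_pblock j (blocks_partition x).
have /refinesP gx := refines_gluel y x; have /refinesP gy := refines_gluer y x.
have [C CG BC] := gy B By.
have inC l : l \in B -> pblock (blocks x) l \subset C.
  move=> lB; have [Pl lPl] := partition_pblock l (blocks_partition x).
  have [D DG lD] := gx _ Pl.
  have lC := subsetP BC l lB; have lD' := subsetP lD l lPl.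
  by rewrite (mem_partition_eq (glue_components_partition y x) CG DG lC lD').
apply: (alpha_glue_eq0 CG).
have := glue_dots_ge2 y Px Pj _ (inC i iB) (inC j jB).
by rewrite !x1 //; apply; apply: contraNneq jP => ->.
Qed.

(** Here the components are the blocks of [x], each already carrying a dot, so
    that any dot of [y] is a second one. *)
Lemma alpha_glue_dotted_mul_eq0 y x B :
  {in blocks x, forall B, dots x B = 1%N} ->
  refines (blocks y) (blocks x) -> B \in blocks y -> (0 < dots y B)%N ->
  alpha (glue y x) = 0.
Proof.
move=> x1 yx By d0; have /refinesP/(_ B By) [C Cx BC] := yx.
have CG : C \in glue_components y x by rewrite glue_refined.
apply: (alpha_glue_eq0 CG).
have := glue_dots_geD Cx By (subxx C) BC; rewrite x1 //.
by apply: leq_trans; lia.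
Qed.

(** A common pair closes up to a circle carrying the dot of [x], whose value is
    [gamma1], or zero if [y] puts further dots on it. *)
Lemma alpha_glue_dotted_circle y x B :
  B \in blocks x -> B \in blocks y -> #|B| != 1%N -> dots x B = 1%N ->
  beta1 * gamma1 = 0 -> beta1 * alpha (glue y x) = 0.
Proof.
move=> Bx By B1 d1 bg; have CG := common_block_component Bx By.
rewrite alpha_glue (bigD1 B CG).
suff h : beta1 * alpha_component (glue_shape y x B, glue_dots y x B) = 0.
  by rewrite /= mulrCA (mulrA beta1) h mul0r mulr0.
rewrite glue_dots_block // d1.
have -> : glue_shape y x B = Defs.Circle.
  rewrite /glue_shape ifF //; apply/exists_inP => -[D Dxy /andP[DB D1]].
  suff eD : D = B by rewrite eD (negbTE B1) in D1.
  case/setUP: Dxy => Dz; have [i iD] := partition_point (blocks_partition _) Dz;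
  by apply: (mem_partition_eq (blocks_partition _) Dz _ iD (subsetP DB i iD)).
by case: (dots y B) => [|d]; rewrite //= mulr0.
Qed.

(** * The relation between diagrams in the degenerate case *)

Section Degenerate.
Variables i0 i1 : 'I_n.
Hypothesis i01 : i0 != i1.

Definition paired_blocks : {set {set 'I_n}} :=
  [set i0; i1] |: singletons (~: [set i0; i1]).

Lemma paired_blocks_partition : partition paired_blocks [set: 'I_n].
Proof.
rewrite -(setUCr [set i0; i1]); apply: partitionU1.
- exact: singletons_partition.
- by apply/set0Pn; exists i0; rewrite !inE eqxx.
by rewrite disjoints_subset setCK.
Qed.

Lemma paired_blocks_card2 : [forall B in paired_blocks, #|B| <= 2]%N.
Proof.
apply/forall_inP => B /setU1P[->|/card_singletons -> //].
by rewrite cards2 i01.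
Qed.

Lemma singletons_card2 : [forall B in singletons [set: 'I_n], #|B| <= 2]%N.
Proof. by apply/forall_inP => B /card_singletons ->. Qed.

Definition dotted_singles : dotted_cob n :=
  cob_of (fun=> 1%N) (singletons_partition [set: 'I_n]) singletons_card2.

Definition dotted_pair : dotted_cob n :=
  cob_of (fun=> 1%N) paired_blocks_partition paired_blocks_card2.

Lemma card_dotted_singles :
  #|blocks dotted_singles| = (#|blocks dotted_pair|).+1.
Proof.
have pair_new : [set i0; i1] \notin singletons (~: [set i0; i1]).
  by apply/negP => /card_singletons; rewrite cards2 i01.
rewrite !blocks_cob_of /paired_blocks cardsU1 pair_new.
rewrite /singletons !card_imset; try exact: set1_inj.
by have := cardsC [set i0; i1]; rewrite cards2 i01 cardsT => <-.
Qed.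

Lemma dotted_singles_neq_dotted_pair : dotted_singles != dotted_pair.
Proof. by apply/eqP => e; have := card_dotted_singles; rewrite e; lia. Qed.

(** The case distinction is on [y]: whether its blocks are singletons, whether
    they still lie inside the blocks of [dotted_pair], and whether they carry
    dots. *)
Lemma alpha_glue_degenerate y : beta1 * gamma1 = 0 ->
  alpha (glue y dotted_singles) = beta1 * alpha (glue y dotted_pair).
Proof.
move=> bg.
have s1 : {in blocks dotted_singles, forall B, dots dotted_singles B = 1%N}.
  by move=> B Bs; rewrite dots_cob_of.
have p1 : {in blocks dotted_pair, forall B, dots dotted_pair B = 1%N}.
  by move=> B Bs; rewrite dots_cob_of.
have cs := card_dotted_singles.
have [ys|nys] := boolP (refines (blocks y) (blocks dotted_singles)); last first.
  rewrite (alpha_glue_dotted_sub_eq0 s1 nys); apply/esym.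
  have [/refinesP yp|nyp] := boolP (refines (blocks y) (blocks dotted_pair));
    last first.
    by rewrite (alpha_glue_dotted_sub_eq0 p1 nyp) mulr0.
  have /forall_inPn[B By /exists_inPn nB] := nys.
  have [C Cp BC] := yp B By.
  (* A block of [y] that is no singleton can only lie inside the pair, and
     then it is the pair. *)
  have eC : C = [set i0; i1].
    case/setU1P: Cp => // /imsetP[i _ eC]; move: (nB [set i]).
    by rewrite mem_singletons inE -eC BC => /(_ isT).
  have B1 : #|B| != 1%N.
    apply: contraT; rewrite negbK => /cards1P[i eB]; move: (nB [set i]).
    by rewrite mem_singletons inE eB subxx => /(_ isT).
  have eB : B = [set i0; i1].
    apply/eqP; rewrite eqEcard -eC BC eC cards2 i01 /=.
    have : (0 < #|B|)%N.
      by rewrite card_gt0 (partition_neq0 (blocks_partition y) By).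
    by move: B1; case: #|B| => [|[]].
  have Bp : B \in blocks dotted_pair by rewrite eB; apply/setU1P; left.
  by apply: (alpha_glue_dotted_circle Bp By B1 (p1 _ Bp) bg).
have y1 : {in blocks y, forall B, exists i, B = [set i]}.
  move=> B By; have /refinesP/(_ B By)[C /imsetP[i _ ->]] := ys.
  rewrite subset1 => /orP[/eqP->|/eqP B0]; first by exists i.
  by have := partition_neq0 (blocks_partition y) By; rewrite B0 eqxx.
have yp : refines (blocks y) (blocks dotted_pair).
  apply/refinesP => B /y1 [i ->].
  have [Pi iP] := partition_pblock i paired_blocks_partition.
  by exists (pblock paired_blocks i) => //; rewrite sub1set.
have [/forall_inP y0|/forall_inPn[B By dB]] :=
    boolP [forall B in blocks y, dots y B == 0%N].
  have y1' : {in blocks y, forall B, #|B| = 1%N}.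
    by move=> B /y1[i ->]; rewrite cards1.
  have {}y0 : {in blocks y, forall B, dots y B = 0%N} by move=> B /y0/eqP.
  by rewrite !alpha_glue_all_dotted // cs exprS mulrCA.
rewrite -lt0n in dB.
by rewrite !(alpha_glue_dotted_mul_eq0 _ _ By dB) // mulr0.
Qed.

End Degenerate.
End Pairing.
End Evaluation.

(** * Linear spans of families *)

Section Spanning.
Variables (k : fieldType) (V : lmodType k) (I : eqType) (b : I -> V).

Definition in_span (v : V) := exists (s : seq I) (c : I -> k),
    uniq s /\ v = \sum_(i <- s) c i *: b i.

Lemma in_span0 : in_span 0.
Proof. by exists [::], (fun=> 0); rewrite big_nil. Qed.

Lemma in_span_gen i : in_span (b i).
Proof. by exists [:: i], (fun=> 1); rewrite big_seq1 scale1r. Qed.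

Lemma in_spanZ a v : in_span v -> in_span (a *: v).
Proof.
move=> [s [c [us ->]]]; exists s, (fun i => a * c i); split=> //.
by rewrite scaler_sumr; apply: eq_bigr => i _; rewrite scalerA.
Qed.

(** Lists of indices have to stay duplicate-free, so two combinations are
    added after extending both by zero to a common list. *)
Lemma sum_subset_zero_ext (s t : seq I) (c : I -> k) :
  uniq s -> uniq t -> {subset s <= t} ->
  \sum_(i <- s) c i *: b i
    = \sum_(i <- t) (if i \in s then c i else 0) *: b i.
Proof.
move=> us ut st.
rewrite [RHS](eq_bigr (fun i => if i \in s then c i *: b i else 0)).
  rewrite -big_mkcond -[RHS]big_filter; apply: perm_big.
  apply: uniq_perm; rewrite ?filter_uniq // => i; rewrite mem_filter.
  by case is_: (i \in s); rewrite // st.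
by move=> i _; case: ifP; rewrite ?scale0r.
Qed.

Lemma in_spanD u v : in_span u -> in_span v -> in_span (u + v).
Proof.
move=> [s [c [us ->]]] [t [d [ut ->]]].
exists (undup (s ++ t)), (fun i => (if i \in s then c i else 0)
                               + (if i \in t then d i else 0)).
split; first exact: undup_uniq.
rewrite (sum_subset_zero_ext (t := undup (s ++ t)) c us) ?undup_uniq //;
    last first.
  by move=> i; rewrite mem_undup mem_cat => ->.
rewrite (sum_subset_zero_ext (t := undup (s ++ t)) d ut) ?undup_uniq //;
    last first.
  by move=> i; rewrite mem_undup mem_cat orbC => ->.
by rewrite -big_split; apply: eq_bigr => i _; rewrite scalerDl.
Qed.

End Spanning.

(** * Diagrams in the state space *)

Section StateSpace.
Variables (k : fieldType) (beta0 beta1 gamma0 gamma1 : k) (n : nat).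
Local Notation alpha := (alpha beta0 beta1 gamma0 gamma1).
Local Notation cob_form := (@cob_form k beta0 beta1 gamma0 gamma1 n).
Local Notation cls := (@state_class k beta0 beta1 gamma0 gamma1 n).
Local Notation scalerker :=
  (@cob_kernel_scaler_closed k beta0 beta1 gamma0 gamma1 n).
Implicit Types (x y : dotted_cob n) (u v : cob_space k n).

(** Naming the basis vector as an element of [cob_space] fixes the module
    structure in which it is scaled. *)
Definition cob_vector x : cob_space k n := << x >>.

Lemma cob_form0 v : cob_form 0 v = 0.
Proof. by rewrite /cob_form msupp0 big_seq_fset0. Qed.

Lemma cob_form_sum (I : Type) (s : seq I) (c : I -> k)
    (X : I -> cob_space k n) v :
  cob_form (\sum_(i <- s) c i *: X i) v = \sum_(i <- s) c i * cob_form (X i) v.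
Proof.
elim: s => [|i s IH]; first by rewrite !big_nil cob_form0.
by rewrite !big_cons cob_form_linear IH.
Qed.

Lemma cob_formUl x v :
  cob_form (cob_vector x) v = \sum_(y <- msupp v) v@_y * alpha (glue y x).
Proof.
rewrite /cob_form /cob_vector msuppU oner_eq0 big_seq_fset1.
by apply: eq_bigr => y _; rewrite mcoeffUU mul1r.
Qed.

Lemma cob_formU x y : cob_form (cob_vector x) (cob_vector y) = alpha (glue y x).
Proof.
by rewrite cob_formUl /cob_vector msuppU oner_eq0 big_seq_fset1 mcoeffUU mul1r.
Qed.

Lemma cob_vectorZ a x : a *: cob_vector x = << a *g x >>.
Proof.
have h (z : k) (w : {malg k[dotted_cob n]}) y : (z *: w)@_y = z * w@_y.
  exact: mcoeffZ.
have e (z : k) y : << z *g x >>@_y = z *+ (x == y) by exact: mcoeffU.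
apply/malgP => y; rewrite [LHS]h [RHS]e [X in _ * X](e 1).
by rewrite mulrnAr mulr1.
Qed.

Lemma class_scaleE a x :
  a *: cls x = lmod_pi scalerker (a *: cob_vector x).
Proof. exact: (lmod_quot_scaleE scalerker a (cob_vector x)). Qed.

Lemma class_sum (I : Type) (s : seq I) (c : I -> k) (X : I -> dotted_cob n) :
  \sum_(i <- s) c i *: cls (X i) =
  lmod_pi scalerker (\sum_(i <- s) c i *: cob_vector (X i)).
Proof.
elim: s => [|i s IH]; first by rewrite !big_nil linear0.
by rewrite !big_cons lmod_piD -IH class_scaleE.
Qed.

(** By bilinearity, membership in the kernel can be tested on basis
    cobordisms, which turns linear relations in the state space into scalar
    ones. *)
Lemma class_sum_eq0P (I : Type) (s : seq I) (c : I -> k)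
    (X : I -> dotted_cob n) :
  \sum_(i <- s) c i *: cls (X i) = 0 <->
  forall y, \sum_(i <- s) c i * alpha (glue y (X i)) = 0.
Proof.
set S := \sum_(i <- s) c i *: cob_vector (X i).
have formS v : cob_form S v = \sum_(i <- s) c i * cob_form (cob_vector (X i)) v.
  exact: cob_form_sum.
rewrite class_sum -/S -(linear0 (lmod_pi scalerker)).
split=> [/lmod_pi_eq|h].
  rewrite subr0 => /cob_kernelP kS y; rewrite -[RHS](kS (cob_vector y)) formS.
  by apply: eq_bigr => i _; rewrite cob_formU.
apply/lmod_pi_eq; rewrite subr0; apply/cob_kernelP => v; rewrite formS.
under eq_bigr do rewrite cob_formUl mulr_sumr.
rewrite exchange_big big1 //= => y _.
under eq_bigr do rewrite mulrCA.
by rewrite -mulr_sumr h mulr0.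
Qed.

Lemma class_scale x y (a : k) :
  (forall z, alpha (glue z x) = a * alpha (glue z y)) -> cls x = a *: cls y.
Proof.
move=> h; apply/eqP; rewrite -subr_eq0; apply/eqP.
have := class_sum_eq0P [:: (1, x); (- a, y)] fst snd.
rewrite /= !big_cons !big_nil /= scale1r addr0 scaleNr => -[_]; apply=> z.
by rewrite !big_cons big_nil h /= mul1r addr0 mulNr subrr.
Qed.

(** Closed components act by their evaluation, and two dots on a block stay on
    one component under every gluing. *)
Lemma class_in_span x : in_span (fun D : diagram n => cls D) (cls x).
Proof.
have [/forall_inP d1|/forall_inPn[B Bx]] :=
    boolP [forall B in blocks x, dots x B <= 1]%N; last first.
  rewrite -ltnNge => dB.
  suff -> : cls x = 0 by exact: in_span0.
  rewrite -(scale0r (cls x)); apply: class_scale => z; rewrite mul0r.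
  have /refinesP/(_ B Bx)[C CG BC] := refines_gluel z x.
  exact: alpha_glue_eq0 CG (leq_trans dB (glue_dots_gel z Bx BC)).
pose D := redot x (dots x).
have dD : is_diagram D by apply: cob_of_diagram.
suff -> : cls x = alpha (closed_part x) *: cls (Diagram dD).
  by apply: in_spanZ; apply: in_span_gen.
apply: class_scale => z; rewrite !alpha_glue /= alpha0 mul1r -mulrA.
congr (_ * (_ * _)); apply: eq_bigr => C _.
congr (alpha_component _ _ _ _ (_, _)); rewrite /glue_dots; congr addn.
by apply: eq_bigr => B /andP[Bx _]; rewrite dots_cob_of.
Qed.

Lemma diagrams_spanning : spanning (fun D : diagram n => cls D).
Proof.
move=> v; have [u ->] := lmod_pi_surj v.
have -> : u = \sum_(x <- msupp u) u@_x *: cob_vector x.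
  rewrite {1}[u]monalgE; apply: eq_bigr => x _.
  by rewrite cob_vectorZ.
rewrite -(class_sum _ _ id).
apply: (big_ind (in_span (fun D : diagram n => cls D))).
- exact: in_span0.
- exact: in_spanD.
by move=> x _; apply: in_spanZ; apply: class_in_span.
Qed.

(** Pairing a relation with the dual of [D] leaves only [D] and the diagrams of
    smaller weight, so the coefficients vanish by induction on the weight. *)
Lemma diagrams_lin_indep : beta1 * gamma1 != 0 ->
  lin_indep (fun D : diagram n => cls D).
Proof.
move=> bg s c us /class_sum_eq0P h D.
have [m] := ubnP (weight D); elim: m D => // m IH D wD Ds.
have /eqP := h (dual D); rewrite (bigD1_seq D) //= big_seq_cond big1 ?addr0.
  rewrite mulf_eq0 (negbTE (alpha_glue_dual_neq0 _ _ _ _)) //; last exact: valP.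
  by rewrite orbF => /eqP.
move=> E /andP[Es]; rewrite eq_sym -val_eqE => DE'.
have [DE|ED'] := leqP (weight D) (weight E).
  rewrite alpha_glue_dual_eq0 ?mulr0 //; exact: valP.
by rewrite IH ?mul0r //; apply: leq_trans ED' _.
Qed.

Lemma diagrams_lin_dep (i0 i1 : 'I_n) : i0 != i1 -> beta1 * gamma1 = 0 ->
  ~ lin_indep (fun D : diagram n => cls D).
Proof.
move=> i01 bg indep.
have ds : is_diagram (dotted_singles n) by apply: cob_of_diagram.
have dp : is_diagram (dotted_pair i01) by apply: cob_of_diagram.
pose c (D : diagram n) : k := if D == Diagram ds then 1 else - beta1.
have sp : Diagram dp != Diagram ds.
  by rewrite eq_sym -val_eqE; apply: dotted_singles_neq_dotted_pair.
pose s := [:: Diagram ds; Diagram dp].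
have us : uniq s by rewrite /= inE eq_sym sp.
have rel : \sum_(D <- s) c D *: cls D = 0.
  apply/class_sum_eq0P => y; rewrite !big_cons big_nil /c eqxx (negbTE sp).
  by rewrite addr0 mul1r mulNr /= (alpha_glue_degenerate _ _ i01) // subrr.
have /eqP := indep s c us rel (Diagram ds) (mem_head _ _).
by rewrite /c eqxx oner_eq0.
Qed.

End StateSpace.

Theorem proposition2p8 (k : fieldType) (beta0 beta1 gamma0 gamma1 : k)
    (n : nat) (hn : (2 <= n)%N) :
  is_basis (fun D : diagram n => state_class beta0 beta1 gamma0 gamma1 D)
  <-> beta1 * gamma1 != 0.
Proof.
split=> [[indep _]|bg].
  apply/eqP => bg; pose i0 := Ordinal (ltnW hn); pose i1 := Ordinal hn.
  by apply: (@diagrams_lin_dep _ beta0 beta1 gamma0 gamma1 _ i0 i1).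
by split; [exact: diagrams_lin_indep | exact: diagrams_spanning].
Qed.
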